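(* $$\sum_{n\ge 0}E_n^{+}\frac{x^n}{n!}=\frac12\big(\sec x+\tan x+\cos x+x\big),\qquad \sum_{n\ge 0}E_n^{-}\frac{x^n}{n!}=\frac12\big(\sec x+\tan x-\cos x-x\big).$$
   Context: A permutation $\pi=\pi_1\cdots\pi_n\in\mathfrak{S}_n$ is alternating if $\pi_1>\pi_2<\pi_3>\pi_4<\cdots$, i.e. $\pi_i>\pi_{i+1}$ for odd $i$ and $\pi_i<\pi_{i+1}$ for even $i$. Let $\mathcal{A}_n$ be the set of permutations in $\mathfrak{S}_n$ with an even number of inversions ($\mathrm{inv}(\pi)=|\{i<j:\pi_i>\pi_j\}|$). For $n\ge1$, $E_n^+$ is the number of alternating permutations in $\mathcal{A}_n$ and $E_n^-$ the number of alternating permutations in $\mathfrak{S}_n\setminus\mathcal{A}_n$; by convention $E_0^+=1$, $E_0^-=0$. *)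

(* Defs.v *)
From mathcomp Require Import all_boot all_order all_algebra perm.
From mathcomp Require Import all_classical all_reals all_analysis.

Set Implicit Arguments.
Unset Strict Implicit.
Unset Printing Implicit Defensive.

Import Order.TTheory GRing.Theory Num.Theory.
Import numFieldNormedType.Exports.

(* Positions and values are 0-based: position i : 'I_n stands for i + 1, so the
   descents at odd positions of the usual 1-based convention occur at even i. *)
Definition alternating n (s : 'S_n) : bool :=
  [forall i : 'I_n, forall j : 'I_n, (j == i.+1 :> nat) ==>
     (if odd i then s i < s j else s j < s i)%N].

Definition inversions n (s : 'S_n) : nat :=
  #|[set p : 'I_n * 'I_n | (p.1 < p.2)%N && (s p.2 < s p.1)%N]|.

Definition even_perms n : {set 'S_n} := [set s : 'S_n | ~~ odd (inversions s)].

Definition Eplus n : nat := #|[set s in even_perms n | alternating s]|.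

Definition Eminus n : nat := #|[set s in ~: even_perms n | alternating s]|.

(* At n = 0 the definitions count the unique (empty) permutation, which agrees
   with the convention E_0^+ = 1 and E_0^- = 0. *)
Lemma even_perms0 (s : 'S_0) : s \in even_perms 0.
Proof.
rewrite inE /inversions (_ : [set _ | _] = finset.set0) ?cards0 //.
by apply/setP => -[[]].
Qed.

Lemma Eplus0 : Eplus 0 = 1%N.
Proof.
rewrite /Eplus (_ : [set _ in _ | _] = [set: 'S_0]%SET).
  by rewrite cardsT card_Sn.
apply/setP => s; rewrite finset.in_setT inE even_perms0 /=.
by apply/forallP => -[].
Qed.

Lemma Eminus0 : Eminus 0 = 0%N.
Proof.
rewrite /Eminus (_ : [set _ in _ | _] = finset.set0) ?cards0 //.
by apply/setP => s; rewrite inE finset.in_setC even_perms0 finset.in_set0.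
Qed.

Local Open Scope ring_scope.

Definition sec {R : realType} (x : R) : R := (cos x)^-1.

Definition egf_series {R : realType} (a : nat -> nat) (x : R) : nat -> R :=
  pseries (fun n => (a n)%:R / n`!%:R) x.

(* Main.v *)
Require Import Defs.
From mathcomp Require Import all_boot all_order all_algebra fingroup perm.
From mathcomp Require Import all_classical all_reals all_analysis.
From mathcomp Require Import zify ring lra.
Import Order.TTheory GRing.Theory Num.Theory.
Import numFieldNormedType.Exports.
(* Restores [Defs.alternating], shadowed by [trigo.alternating]. *)
Import Defs.

Set Implicit Arguments.
Unset Strict Implicit.
Unset Printing Implicit Defensive.

(* Let E n and D n be the sum and the difference of the two counts. Splitting an
   alternating permutation at its maximum gives André's recurrence
   2 E (n+1) = sum_k C(n,k) E k E (n-k) for n > 0, so the partial sums S_N of the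
   exponential generating function of E satisfy 2 S_(N+1)' <= 1 + S_N^2 on
   [0, pi/2). Hence atan (S_N x) <= pi/4 + x/2, which yields convergence, and in
   the limit 2 f' = 1 + f^2, i.e. f x = tan (pi/4 + x/2) = sec x + tan x.
   For D, pair the values {2j, 2j+1} (n even) or {2j+1, 2j+2} (n odd) and swap the
   first pair whose values are not at adjacent positions: this is a sign-reversing
   involution on alternating permutations. The only permutation left is
   2 1 4 3 ... for n even, and there is none for odd n > 1. *)

(** * Counting alternating permutations *)

(* [b] tells whether the first step is an ascent; the permutations to be counted
   are the case [b = false]. *)
Fixpoint alt (b : bool) (w : seq nat) : bool :=
  if w is x :: w' then
    (if w' is y :: _ then if b then x < y else y < x else true) && alt (~~ b) w'
  else true.

Lemma alt_cons2 b x y w :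
  alt b (x :: y :: w) = (if b then x < y else y < x) && alt (~~ b) (y :: w).
Proof. by []. Qed.

Lemma alt_nth b w : reflect
  (forall i, i.+1 < size w -> if b (+) odd i
     then nth 0 w i < nth 0 w i.+1 else nth 0 w i.+1 < nth 0 w i)
  (alt b w).
Proof.
elim: w b => [|x [|y w] IHw] b; first by left.
  by left=> i /=; rewrite ltnS ltn0.
rewrite alt_cons2; apply: (iffP andP) => [[Hxy /IHw Hw] [|i] Hi|Hw].
- by rewrite addbF.
- by have := Hw i Hi; rewrite addNb -addbN.
split; first by have := Hw 0 isT; rewrite addbF.
by apply/IHw => i Hi; have := Hw i.+1 Hi; rewrite /= addbN addNb.
Qed.

Lemma alt_map b (f : nat -> nat) (D : {pred nat}) w :
  {in D &, {mono f : x y / x < y}} -> {subset w <= D} -> alt b (map f w) = alt b w.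
Proof.
move=> Hf; elim: w b => [|x [|y w] IHw] b // Dw.
rewrite [map f _]/= !alt_cons2.
have [Dx Dy] : x \in D /\ y \in D by split; apply: Dw; rewrite !inE eqxx ?orbT.
rewrite !Hf // -IHw // => z zw; apply: Dw; by rewrite inE zw orbT.
Qed.

Lemma alt_map_decr b (f : nat -> nat) (D : {pred nat}) w :
  {in D &, {mono f : x y /~ x < y}} -> {subset w <= D} ->
  alt b (map f w) = alt (~~ b) w.
Proof.
move=> Hf; elim: w b => [|x [|y w] IHw] b // Dw.
rewrite [map f _]/= !alt_cons2.
have [Dx Dy] : x \in D /\ y \in D by split; apply: Dw; rewrite !inE eqxx ?orbT.
rewrite !Hf // -IHw ?if_neg // => z zw; apply: Dw; by rewrite inE zw orbT.
Qed.

(* Seen from [x], both sides of the word follow the same pattern, the left one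
   being read backwards. *)
Lemma alt_catrev b l x r :
  alt b (catrev l (x :: r)) =
  alt (b (+) odd (size l)) (x :: r) && alt (b (+) odd (size l)) (x :: l).
Proof.
elim: l x r => [|y l IHl] x r; first by rewrite addbF andbT.
rewrite [catrev _ _]/= IHl [size _]/= [odd _]/= addbN !alt_cons2 negbK if_neg.
by case: (b (+) _); case: (_ < _); case: alt; case: alt.
Qed.

Lemma alt_max b x w : {in w, forall y, y < x} ->
  alt b (x :: w) = (w == [::]) || ~~ b && alt true w.
Proof.
case: w => [|y w] // Hx; rewrite alt_cons2.
have yx : y < x by rewrite Hx ?inE ?eqxx.
by case: b => //=; [rewrite ltnNge ltnW|rewrite yx].
Qed.

Lemma perm_permutations_map (T1 T2 : eqType) (f : T1 -> T2) s : uniq s -> {in s &, injective f} ->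
  perm_eq (map (map f) (permutations s)) (permutations (map f s)).
Proof.
move=> Us If.
have Um : uniq (map (map f) (permutations s)).
  rewrite map_inj_in_uniq ?permutations_uniq // => u v.
  rewrite !mem_permutations => /perm_mem us /perm_mem vs.
  by apply: (inj_in_map If); apply/allP => a; rewrite ?us ?vs.
apply: uniq_perm; [by []|exact: permutations_uniq|].
apply: (uniq_min_size Um _ _).2; last first.
  by rewrite size_map !size_permutations ?size_map ?map_inj_in_uniq.
move=> _ /mapP[v Hv ->]; rewrite mem_permutations in Hv.
by rewrite mem_permutations; exact: perm_map.
Qed.

(** Lists rather than permutations, so that the values may form any set; type [true] because each
    side of a maximum, read away from it, starts with an ascent. *)
Definition zigzag (s : seq nat) : nat := count (alt true) (permutations s).

(** Only the relative order of the values matters: [nth 0 s] is an increasing relabelling. *)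
Lemma zigzag_sorted s : sorted ltn s -> zigzag s = zigzag (iota 0 (size s)).
Proof.
move=> Hs; rewrite /zigzag -{1}(mkseq_nth 0 s).
have Hm : {in gtn (size s) &, {mono nth 0 s : x y / x < y}}.
  have Hh := sorted_ltn_nth ltn_trans 0 Hs.
  by apply: leqW_mono_in; apply: leq_mono_in.
have /seq.permP <- : perm_eq (map (map (nth 0 s)) (permutations (iota 0 (size s))))
                   (permutations (mkseq (nth 0 s) (size s))).
  apply: perm_permutations_map (iota_uniq _ _) _ => x y.
  rewrite !mem_iota /= => Hx Hy Hxy; apply/eqP.
  by rewrite -(nth_uniq 0 Hx Hy) ?Hxy ?eqxx // (sorted_uniq ltn_trans ltnn).
rewrite count_map; apply: eq_in_count => w /=.
rewrite mem_permutations => /perm_mem Hw.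
by rewrite (alt_map _ Hm) // => x; rewrite Hw mem_iota.
Qed.

(** The complement [i -> n - 1 - i] reverses all comparisons and so exchanges the two types. *)
Lemma zigzag_down n :
  count (alt false) (permutations (iota 0 n)) = zigzag (iota 0 n).
Proof.
pose f i := n.-1 - i.
have If : {in iota 0 n &, injective f}.
  by move=> x y; rewrite !mem_iota /f; lia.
have Pf : perm_eq (map f (iota 0 n)) (iota 0 n).
  have Uf : uniq (map f (iota 0 n)) by rewrite map_inj_in_uniq // iota_uniq.
  apply: uniq_perm => //; first exact: iota_uniq.
  apply: (uniq_min_size Uf _ _).2; last by rewrite size_map.
  by move=> _ /mapP[i Hi ->]; move: Hi; rewrite !mem_iota /f; lia.
rewrite /zigzag -(seq.permP (perm_permutations Pf)).
rewrite -(seq.permP (perm_permutations_map (iota_uniq 0 n) If)) count_map.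
apply: eq_in_count => w /=; rewrite mem_permutations => /perm_mem Hw.
rewrite (@alt_map_decr false f [pred i | i < n]) //.
  by move=> x y; rewrite !inE /f; lia.
by move=> x; rewrite Hw mem_iota.
Qed.

(** * Splitting words at their maximum *)

Definition vals n (A : {set 'I_n}) : seq nat := [seq val i | i <- enum A].

Lemma mem_vals n (A : {set 'I_n}) (i : 'I_n) : (val i \in vals A) = (i \in A).
Proof. by rewrite (mem_map val_inj) mem_enum. Qed.

Lemma vals_lt n (A : {set 'I_n}) : {in vals A, forall x, x < n}.
Proof. by move=> _ /mapP[i _ ->]; exact: ltn_ord. Qed.

Lemma vals_uniq n (A : {set 'I_n}) : uniq (vals A).
Proof. by rewrite (map_inj_uniq val_inj) enum_uniq. Qed.

Lemma zigzag_vals n (A : {set 'I_n}) : zigzag (vals A) = zigzag (iota 0 #|A|).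
Proof.
rewrite zigzag_sorted ?size_map -?cardE // sorted_map /enum_mem.
apply: sorted_filter; first by move=> y x z; exact: ltn_trans.
by rewrite -enumT -sorted_map val_enum_ord iota_ltn_sorted.
Qed.

(** [A] is the set of values to the left of the maximum [n]. The left side is listed backwards,
    hence [catrev]: both words start next to [n]. *)
Lemma permutations_split_max n :
  perm_eq (permutations (iota 0 n.+1))
    [seq catrev lr.1 (n :: lr.2) | A <- enum {: {set 'I_n}},
       lr <- [seq (l, r) | l <- permutations (vals A),
                           r <- permutations (vals (~: A))]].
Proof.
apply: uniq_perm; first exact: permutations_uniq.
  apply: allpairs_uniq_dep; first exact: enum_uniq.
    move=> A _; apply: allpairs_uniq; try exact: permutations_uniq.
    by move=> [l r] [l' r'] _ _ [-> ->].
  move=> [A lr] [A' lr'] /allpairsPdep[B [lr1 [_ /allpairsP[[l r] [/= Hl Hr ->]] [-> ->]]]].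
  move=> /allpairsPdep[B' [lr1' [_ /allpairsP[[l' r'] [/= Hl' Hr' ->]] [-> ->]]]] /=.
  move: Hl Hl'; rewrite !mem_permutations => /perm_mem Hl /perm_mem Hl' E.
  have nl C : n \notin @vals n C by apply/negP => /vals_lt; rewrite ltnn.
  have [ll rr] : l = l' /\ r = r'.
    have nl1 : n \notin rev l by rewrite mem_rev Hl.
    have nl2 : n \notin rev l' by rewrite mem_rev Hl'.
    move: E; rewrite !catrevE => E.
    (* Neither left side contains [n], so the index of [n] in the common word is the length of
       both. *)
    have sz : size (rev l) = size (rev l').
      by have := congr1 (index n) E; rewrite !index_cat (negPf nl1) (negPf nl2) /= eqxx !addn0.
    by move/eqP: E; rewrite eqseq_cat // => /andP[/eqP/(inv_inj revK) -> /eqP[->]].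
  have BB : B = B' by apply/setP => i; rewrite -!mem_vals -Hl -Hl' ll.
  by rewrite BB ll rr.
move=> w; rewrite mem_permutations; apply/idP/allpairsPdep => [Hw|].
  have nw : n \in w by rewrite (perm_mem Hw) mem_iota; lia.
  have Uw : uniq w by rewrite (perm_uniq Hw) iota_uniq.
  case/splitPr: nw Hw Uw => p1 p2 Hw; rewrite cat_uniq /= => /and3P[U1 U12 /andP[n2 U2]].
  move: U12; rewrite negb_or => /andP[n1 /hasPn U12].
  have lt i : i \in p1 ++ p2 -> i < n.
    move=> ip; have := perm_mem Hw i; rewrite mem_iota.
    have : i != n by apply/eqP => e; move: ip; rewrite e mem_cat (negPf n1) (negPf n2).
    by move: ip; rewrite !mem_cat inE; case: (i \in p1); case: (i \in p2); lia.
  pose A := [set i : 'I_n | val i \in p1].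
  exists A, (rev p1, p2); split; [by rewrite mem_enum| |by rewrite /= catrevE revK].
  apply/allpairsP; exists (rev p1, p2); split=> //=; rewrite mem_permutations.
    apply: uniq_perm; rewrite ?rev_uniq ?vals_uniq // => i; rewrite mem_rev.
    apply/idP/mapP => [ip|[j]]; last by rewrite mem_enum inE => ? ->.
    have il : i < n by apply: lt; rewrite mem_cat ip.
    by exists (Ordinal il); rewrite // mem_enum inE.
  apply: uniq_perm; rewrite ?vals_uniq // => i.
  apply/idP/mapP => [ip|[j]].
    have il : i < n by apply: lt; rewrite mem_cat ip orbT.
    by exists (Ordinal il); rewrite // mem_enum !inE /= U12.
  rewrite mem_enum !inE => jp ->; have := perm_mem Hw j.
  rewrite mem_cat inE (negPf jp) mem_iota /= add0n ltnS (ltnW (ltn_ord j)).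
  by rewrite ltn_eqF.
move=> [A [_ [_ /allpairsP[[l r] [Hl Hr ->]] ->]]].
rewrite !mem_permutations in Hl Hr.
rewrite -[n.+1]addn1 iotaD cats1 perm_sym perm_rcons perm_sym.
rewrite catrevE -cat1s perm_catCA perm_cons.
apply: (@perm_trans _ (vals A ++ vals (~: A))).
  by apply: perm_cat => //; rewrite perm_rev.
apply: uniq_perm; rewrite ?iota_uniq // ?cat_uniq ?vals_uniq ?andbT /=.
  apply/hasPn => _ /mapP[i + ->]; rewrite mem_enum => iA.
  by rewrite mem_vals; move: iA; rewrite inE.
move=> x; rewrite mem_cat mem_iota /= add0n; apply/idP/idP => [/orP[] /vals_lt //|xn].
by rewrite -[x]/(val (Ordinal xn)) !mem_vals inE orbN.
Qed.

(* Words of both types are counted: once the sides of the maximum are chosen, exactly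
   one type puts it on a peak, and both sides, read away from it, start with an ascent. *)
Lemma zigzag_rec n : 0 < n ->
  (zigzag (iota 0 n.+1)).*2 =
  \sum_(k < n.+1) 'C(n, k) * (zigzag (iota 0 k) * zigzag (iota 0 (n - k))).
Proof.
move=> n_gt0; rewrite -addnn -{1}zigzag_down [in LHS]/zigzag.
rewrite !(seq.permP (permutations_split_max n)) -!sum1_count !(big_mkcond (alt _)).
rewrite -big_split /= big_allpairs_dep big_enum /=.
transitivity (\sum_(A : {set 'I_n}) zigzag (vals A) * zigzag (vals (~: A))).
  apply: eq_bigr => A _; rewrite big_allpairs /=.
  rewrite /zigzag -!sum1_count !(big_mkcond (alt _)) big_distrl /=.
  rewrite !big_seq; apply: eq_bigr => l Hl.
  rewrite big_distrr /= !big_seq; apply: eq_bigr => r Hr.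
  move: Hl Hr; rewrite !mem_permutations => Hl Hr.
  rewrite !alt_catrev !alt_max.
  (* Here [0 < n] matters: a one-letter word has both types and would be counted twice. *)
  - have : ~~ ((l == [::]) && (r == [::])).
      rewrite -!size_eq0 (perm_size Hl) (perm_size Hr) !size_map -!cardE.
      by have := cardsC A; rewrite card_ord; move: #|A| #|~: A| => a b; lia.
    case: (l =P [::]) => [->|_]; case: (r =P [::]) => [->|_] // _; rewrite ?orbT ?orbF.
    + by case: (alt true r).
    + by case: (odd _); case: (alt true l).
    + by case: (odd _); case: (alt true l); case: (alt true r).
  - by move=> y; rewrite ?(perm_mem Hr) ?(perm_mem Hl); exact: vals_lt.
  - by move=> y; rewrite ?(perm_mem Hr) ?(perm_mem Hl); exact: vals_lt.
  - by move=> y; rewrite ?(perm_mem Hr) ?(perm_mem Hl); exact: vals_lt.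
  - by move=> y; rewrite ?(perm_mem Hr) ?(perm_mem Hl); exact: vals_lt.
rewrite (partition_big (fun A : {set 'I_n} => inord #|A| : 'I_n.+1) xpredT) //=.
apply: eq_bigr => k _.
transitivity (\sum_(A : {set 'I_n} | #|A| == k) zigzag (iota 0 k) * zigzag (iota 0 (n - k))).
  have cA (A : {set 'I_n}) : #|A| <= n by rewrite -[n in _ <= n]card_ord max_card.
  apply: eq_big => [A|A /eqP Ak]; first by rewrite -val_eqE /= inordK ?ltnS ?cA.
  have cAC : #|~: A| = n - #|A|.
    by have := cardsC A; rewrite card_ord; move: #|A| #|~: A| => a b; lia.
  by rewrite !zigzag_vals cAC -Ak inordK ?ltnS ?cA.
by rewrite sum_nat_const; congr (_ * _); have := card_draws 'I_n k; rewrite cardsE card_ord.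
Qed.

(** * Permutations as words *)

Definition word n (s : 'S_n) : seq nat := [seq val (s i) | i <- enum 'I_n].

Lemma size_word n (s : 'S_n) : size (word s) = n.
Proof. by rewrite size_map size_enum_ord. Qed.

Lemma nth_word n (s : 'S_n) (i : 'I_n) : nth 0 (word s) i = s i.
Proof. by rewrite (nth_map i) ?size_enum_ord // nth_ord_enum. Qed.

Lemma alternatingP n (s : 'S_n) : reflect
  (forall i j : 'I_n, j = i.+1 :> nat -> if odd i then s i < s j else s j < s i)
  (alternating s).
Proof.
apply: (iffP forallP) => [H i j ij|H i]; first by have /forallP/(_ j)/implyP := H i; apply; apply/eqP.
by apply/forallP => j; apply/implyP => /eqP; apply: H.
Qed.

Lemma alternating_word n (s : 'S_n) : alternating s = alt false (word s).
Proof.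
apply/alternatingP/alt_nth => [H i|H i j ij]; rewrite ?size_word.
  move=> i1; have := H (Ordinal (ltnW i1)) (Ordinal i1) erefl.
  by rewrite -!nth_word.
by rewrite -!nth_word ij; apply: (H i); rewrite size_word -ij ltn_ord.
Qed.

Lemma perm_words n :
  perm_eq [seq word s | s <- enum 'S_n] (permutations (iota 0 n)).
Proof.
have Uw : uniq [seq word s | s <- enum 'S_n].
  rewrite map_inj_uniq ?enum_uniq // => s t st.
  by apply/permP => i; apply: val_inj; rewrite /= -!nth_word st.
apply: uniq_perm; [by []|exact: permutations_uniq|].
apply: (uniq_min_size Uw _ _).2; last first.
  by rewrite size_permutations ?iota_uniq // size_iota size_map -cardE card_Sn.
move=> _ /mapP[s _ ->]; rewrite mem_permutations -val_enum_ord /word map_comp.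
apply: perm_map; apply: uniq_perm; rewrite ?enum_uniq //.
  by rewrite (map_inj_uniq (@perm_inj _ s)) enum_uniq.
by move=> i; rewrite mem_enum -[i in i \in _](permKV s) (mem_map (@perm_inj _ s)) mem_enum.
Qed.

Lemma EplusDEminus n : Eplus n + Eminus n = zigzag (iota 0 n).
Proof.
rewrite -zigzag_down -(seq.permP (perm_words n)) count_map.
rewrite (eq_count (a2 := @alternating n)) => [|s]; last by rewrite /= alternating_word.
rewrite -sum1_count big_enum_cond /= sum1dep_card -(cardsID (even_perms n)).
by congr (_ + _); apply: eq_card => s; rewrite !inE // andbC.
Qed.

(** * The signed count *)

Section ConsecutiveSwap.
Variables (n : nat) (v w : 'I_n).
Hypothesis vw : w = v.+1 :> nat.

(** No value lies strictly between [v] and [w], so only the comparison of these two is affected. *)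
Lemma tperm_consecutive_lt (x y : 'I_n) :
  ~~ ((x == v) && (y == w) || (x == w) && (y == v)) ->
  (tperm v w x < tperm v w y) = (x < y).
Proof.
have := vw; rewrite -!val_eqE /=.
case: (tpermP v w x) => [->|->|/eqP + /eqP +];
  case: (tpermP v w y) => [->|->|/eqP + /eqP +]; rewrite -?val_eqE /=; lia.
Qed.

(** Let [e] be the ordered pair of positions of [v] and [w]. Every other pair keeps its status,
    whereas [e] becomes an inversion or ceases to be one. *)
Lemma odd_inversions_swap (s : 'S_n) :
  odd (inversions (s * tperm v w)) = ~~ odd (inversions s).
Proof.
pose p := (s^-1)%g v; pose q := (s^-1)%g w.
have sp : s p = v by rewrite permKV.
have sq : s q = w by rewrite permKV.
have pq : p != q by rewrite (inj_eq perm_inj) -val_eqE /= vw ltn_eqF.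
pose e := if p < q then (p, q) else (q, p).
pose inv (t : 'S_n) := [set a : 'I_n * 'I_n | (a.1 < a.2) && (t a.2 < t a.1)].
rewrite /inversions -!/(inv _) (cardsD1 e (inv s)) (cardsD1 e (inv (s * _)%g)).
have -> : inv (s * tperm v w)%g :\ e = inv s :\ e.
  apply/setP => -[a b]; rewrite !inE !permM /=.
  case: eqVneq => //= abe; case: ltnP => //= ab.
  rewrite tperm_consecutive_lt //; apply: contra abe.
  have ca (c : 'I_n) x : (s c == x) = (c == (s^-1)%g x).
    by apply/eqP/eqP => [<-|->]; rewrite ?permK ?permKV.
  rewrite !ca -/p -/q /e => /orP[] /andP[/eqP eb /eqP ea]; move: ab; rewrite ea eb.
    by rewrite ltnNge => /negPf; rewrite leq_eqVlt => /norP[_ /negPf ->].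
  by move=> ->.
have -> : (e \in inv (s * tperm v w)%g) = ~~ (e \in inv s).
  rewrite /e !inE; case: (ltngtP p q) => [|| /val_inj/eqP]; last by rewrite (negPf pq).
    by move=> -> /=; rewrite !permM sp sq tpermL tpermR vw; lia.
  by move=> -> /=; rewrite !permM sp sq tpermL tpermR vw; lia.
by rewrite !oddD !oddb; case: (e \in _); case: (odd _).
Qed.

(** The alternating condition compares neighbouring positions only, hence never [v] with [w]. *)
Lemma alternating_swap (s : 'S_n) :
  let p := (s^-1)%g v in let q := (s^-1)%g w in
  ~~ ((q == p.+1 :> nat) || (p == q.+1 :> nat)) ->
  alternating (s * tperm v w)%g = alternating s.
Proof.
move=> p q npq.
have ca (c : 'I_n) x : (s c == x) = (c == (s^-1)%g x).
  by apply/eqP/eqP => [<-|->]; rewrite ?permK ?permKV.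
apply: eq_forallb => i; apply: eq_forallb => j; case: eqP => //= ij.
rewrite !permM !tperm_consecutive_lt // !ca -/p -/q; apply: contra npq.
  by case/orP => /andP[/eqP <- /eqP <-]; rewrite ij eqxx ?orbT.
by case/orP => /andP[/eqP <- /eqP <-]; rewrite ij eqxx ?orbT.
Qed.

End ConsecutiveSwap.

Definition signed_alt n : int := (\sum_(s : 'S_n | alternating s) (-1) ^+ inversions s)%R.

Lemma signed_altE n : signed_alt n = (Posz (Eplus n) - Posz (Eminus n))%R.
Proof.
rewrite /signed_alt (bigID (mem (even_perms n))) /= -!natz.
congr (_ + _)%R.
  rewrite (eq_bigr (fun _ => 1%R)) => [|s /andP[_]]; last first.
    by rewrite inE -signr_odd => /negPf ->.
  by rewrite sumr_const; congr (_ *+ _)%R; apply: eq_card => s; rewrite [RHS]inE andbC.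
rewrite (eq_bigr (fun _ => (- 1)%R)) => [|s /andP[_]]; last first.
  by rewrite inE negbK -signr_odd => ->.
rewrite sumr_const mulNrn; congr (- (_ *+ _))%R; apply: eq_card => s.
by rewrite [RHS]inE finset.in_setC andbC.
Qed.

(** The offset [o] will be 0 for even [n] and 1 for odd [n], where the value 0 stays unpaired. *)
Section SignReversingInvolution.
Variables (n m o : nat) (lo hi : 'I_m -> 'I_n).
Hypothesis loE : forall j, lo j = j.*2 + o :> nat.
Hypothesis hiE : forall j, hi j = (j.*2 + o).+1 :> nat.

Definition adjacent (s : 'S_n) (j : 'I_m) : bool :=
  let p := (s^-1)%g (lo j) in let q := (s^-1)%g (hi j) in
  (q == p.+1 :> nat) || (p == q.+1 :> nat).

Let lohi j : hi j = (lo j).+1 :> nat.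
Proof. by rewrite hiE loE. Qed.

Let swap (j : 'I_m) (s : 'S_n) : 'S_n := (s * tperm (lo j) (hi j))%g.

(** The pairs are disjoint: swapping pair [j] exchanges its two positions and leaves the other pairs
    in place. *)
Lemma adjacent_swap j s : adjacent (swap j s) =1 adjacent s.
Proof.
move=> k; rewrite /adjacent /swap invgM tpermV !permM.
have [->|/eqP kj] := eqVneq k j; first by rewrite tpermL tpermR orbC.
have kj' : k != j :> nat by apply/eqP => /val_inj.
by rewrite !tpermD // -val_eqE /= !(loE, hiE); move: kj'; lia.
Qed.

Lemma signed_alt_fixed :
  signed_alt n =
  (\sum_(s : 'S_n | alternating s && [forall j, adjacent s j]) (-1) ^+ inversions s)%R.
Proof.
rewrite /signed_alt (bigID (fun s => [forall j, adjacent s j])) /=.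
set S := (X in (_ + X)%R); suff -> : S = 0%R by rewrite addr0.
(* By [adjacent_swap] the same pair is picked before and after the swap, so [phi] is an involution;
   by [alternating_swap] it preserves alternation. *)
pose phi (s : 'S_n) := if [pick j | ~~ adjacent s j] is Some j then swap j s else s.
have pickE j s :
    [pick k | ~~ adjacent (swap j s) k] = [pick k | ~~ adjacent s k].
  by apply: eq_pick => k; rewrite adjacent_swap.
have phiK : involutive phi.
  move=> s; rewrite {2}/phi; case E: [pick j | ~~ adjacent s j] => [j|].
    by rewrite /phi pickE E /swap -mulgA tperm2 mulg1.
  by rewrite /phi E.
suff SN : S = (- S)%R.
  have : (S *+ 2 == 0)%R by rewrite mulr2n {1}SN addNr.
  by rewrite mulrn_eq0 /= => /eqP.
rewrite -sumrN /S (reindex_inj (inv_inj phiK)) /=.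
apply: eq_big => [s|s].
  rewrite /phi; case: pickP => [j Hj|//].
  rewrite alternating_swap //; congr (_ && ~~ _).
  by apply: eq_forallb => k; rewrite adjacent_swap.
rewrite /phi; case: pickP => [j Hj _|H].
  by rewrite -signr_odd odd_inversions_swap // signrN signr_odd.
move=> /andP[_ /negP []]; apply/forallP => j; have := H j; exact: negbFE.
Qed.

End SignReversingInvolution.

(* [f] is a permutation as a function from positions to values, [g] its inverse. *)
Section AdjacentPairsRigid.
Variables (m : nat) (f g : nat -> nat).
Hypothesis f_lt : forall k, k < m.*2 -> f k < m.*2.
Hypothesis g_lt : forall v, v < m.*2 -> g v < m.*2.
Hypothesis fK : forall k, k < m.*2 -> g (f k) = k.
Hypothesis gK : forall v, v < m.*2 -> f (g v) = v.
Hypothesis f_desc : forall i, i < m -> f i.*2.+1 < f i.*2.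
Hypothesis f_asc : forall i, i.+1 < m -> f i.*2.+1 < f i.*2.+2.
Hypothesis g_adj : forall j, j < m ->
  g j.*2.+1 = (g j.*2).+1 \/ g j.*2 = (g j.*2.+1).+1.

(** Induction on [i]: the partner of the value at position [i.*2] is next to it. The position on the
    left is absent or taken by the preceding pair, so the partner is on the right, and the descent
    puts the larger value first. *)
Lemma adjacent_pairs_aligned i : i < m ->
  exists2 j, j < m & f i.*2 = j.*2.+1 /\ f i.*2.+1 = j.*2.
Proof.
have adj k j : k < m.*2 -> j < m -> f k = j.*2 ->
    (k.+1 < m.*2 /\ f k.+1 = j.*2.+1) \/ (0 < k /\ f k.-1 = j.*2.+1).
  move=> km jm fk; have gj : g j.*2 = k by rewrite -fk fK.
  have j1 : j.*2.+1 < m.*2 by lia.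
  have := gK j1; have := g_lt j1.
  have [->|] := g_adj jm; rewrite gj; first by left.
  by move=> ->; right.
have adj' k j : k < m.*2 -> j < m -> f k = j.*2.+1 ->
    (k.+1 < m.*2 /\ f k.+1 = j.*2) \/ (0 < k /\ f k.-1 = j.*2).
  move=> km jm fk; have gj : g j.*2.+1 = k by rewrite -fk fK.
  have j1 : j.*2 < m.*2 by lia.
  have := gK j1; have := g_lt j1.
  by have [|->] := g_adj jm; rewrite gj; [move=> ->; right|left].
elim: i => [|i IHi] im.
  have m0 : 0 < m.*2 by lia.
  have := f_lt m0; have := f_desc im; have := adj 0 (f 0)./2 m0; have := adj' 0 (f 0)./2 m0.
  have := odd_double_half (f 0); rewrite double0 /=; case: (odd _) => /=.
    move=> e H _ d l; exists (f 0)./2; first by lia.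
    by have := H ltac:(lia) ltac:(lia); lia.
  by move=> e _ H d l; have := H ltac:(lia) ltac:(lia); lia.
have [j jm [fi fi1]] := IHi (ltnW im).
have m2 : i.*2.+2 < m.*2 by lia.
have := f_lt m2; have := f_desc im; have := adj _ (f i.*2.+2)./2 m2; have := adj' _ (f i.*2.+2)./2 m2.
rewrite doubleS; have := odd_double_half (f i.*2.+2); rewrite /= fi1; case: (odd _) => /=.
  move=> e H _ d l; exists (f i.*2.+2)./2; first by lia.
  have [] := H ltac:(lia) ltac:(lia); first by lia.
  (* A partner on the left would be [j.*2], so [f] would take the value [j.*2.+1] at both [i.*2] and
     [i.*2.+2]. *)
  move=> [_ jj]; have := congr1 g (_ : f i.*2 = f i.*2.+2); rewrite !fK; [|lia..].
  by move=> /(_ ltac:(lia)); lia.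
by move=> e _ H d l; have := H ltac:(lia) ltac:(lia); lia.
Qed.

(** The positions of block [k] carry the values of block [h k]. The ascents make [h] strictly
    increasing, and a strictly increasing self-map of [0, ..., m - 1] is the identity. *)
Lemma adjacent_pairs_rigid i : i < m -> f i.*2 = i.*2.+1 /\ f i.*2.+1 = i.*2.
Proof.
pose h k := (f k.*2)./2.
have hE k : k < m -> h k < m /\ f k.*2 = (h k).*2.+1 /\ f k.*2.+1 = (h k).*2.
  by move=> /adjacent_pairs_aligned[j jm [e1 e2]]; rewrite /h e1 e2 /= uphalf_double.
have hS k : k.+1 < m -> h k < h k.+1.
  move=> km; have [_ [e1 e2]] := hE _ (ltnW km); have [_ [e3 e4]] := hE _ km.
  have := f_asc km; rewrite e2 -doubleS e3 => H.
  have : h k != h k.+1; last by lia.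
  apply/eqP => E; have := congr1 g (_ : f k.*2 = f k.+1.*2).
  by rewrite !fK ?e1 ?e3 ?E => [/(_ erefl)||]; lia.
have hge k : k < m -> k <= h k.
  by elim: k => [|k IHk] km //; apply: leq_ltn_trans (hS _ km); apply: IHk; lia.
have hle d k : k + d < m -> h k + d <= h (k + d).
  elim: d => [|d IHd]; rewrite ?addn0 // addnS => km.
  by have := hS _ km; have := IHd (ltnW km); lia.
move=> im; have [_ [-> ->]] := hE _ im; suff -> : h i = i by [].
(* Upper bound: [h i + (m - 1 - i) <= h (m - 1) <= m - 1]. *)
have := hle (m.-1 - i) i; have := hge _ im; have [+ _] := hE (i + (m.-1 - i)) ltac:(lia).
by lia.
Qed.
End AdjacentPairsRigid.

Lemma big_ord_odd m (F : nat -> nat) :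
  \sum_(i < m.*2.+1) F i = F 0 + \sum_(j < m) (F j.*2.+1 + F j.*2.+2).
Proof.
elim: m => [|m IHm]; first by rewrite big_ord_recr /= !big_ord0 addnC.
by rewrite doubleS 2!big_ord_recr /= IHm [in RHS]big_ord_recr /=; lia.
Qed.

Section WordFacts.
Variables (n : nat) (s : 'S_n).
Let f := nth 0 (word s).
Let g := nth 0 (word (s^-1)%g).

Lemma nth_word_lt k : k < n -> f k < n.
Proof. by move=> kn; rewrite /f -[k]/(val (Ordinal kn)) nth_word. Qed.

Lemma nth_wordK k : k < n -> g (f k) = k.
Proof. by move=> kn; rewrite /f -[k]/(val (Ordinal kn)) nth_word /g nth_word permK. Qed.

Lemma nth_word_alt : alternating s ->
  forall k, k.+1 < n -> if odd k then f k < f k.+1 else f k.+1 < f k.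
Proof.
rewrite alternating_word => /alt_nth H k kn.
by have := H k; rewrite size_word => /(_ kn).
Qed.
End WordFacts.

Lemma nth_wordVK n (s : 'S_n) k : k < n -> nth 0 (word s) (nth 0 (word (s^-1)%g) k) = k.
Proof. by move=> kn; have := @nth_wordK n (s^-1)%g k kn; rewrite invgK. Qed.

(* Adjacent pairs use as many odd as even positions, which leaves an even position
   for the value 0; but positions are numbered from 0, so the valleys are odd. *)
Lemma signed_alt_odd m : 0 < m -> signed_alt m.*2.+1 = 0%R.
Proof.
move=> m0; pose n := m.*2.+1.
have lo_lt (j : 'I_m) : j.*2 + 1 < n by have := ltn_ord j; rewrite /n; lia.
have hi_lt (j : 'I_m) : (j.*2 + 1).+1 < n by have := ltn_ord j; rewrite /n; lia.
rewrite (@signed_alt_fixed n m 1 (fun j => Ordinal (lo_lt j)) (fun j => Ordinal (hi_lt j))) //.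
apply: big1 => s /andP[alts /forallP adj].
pose f := nth 0 (word s); pose g := nth 0 (word (s^-1)%g).
have adjg j : j < m -> g j.*2.+2 = (g j.*2.+1).+1 \/ g j.*2.+1 = (g j.*2.+2).+1.
  move=> jm; have := adj (Ordinal jm); rewrite /adjacent -!nth_word /= -/g addn1.
  by case/orP => /eqP; [left|right].
have g0n : g 0 < n by exact: nth_word_lt.
have fg0 : f (g 0) = 0 by exact: nth_wordVK.
(* The value 0 sits in a valley: at an even position the word would descend from it or, if that
   position is the last, ascend to it. *)
have g0 : odd (g 0).
  apply/negP => /negP g0.
  case: (ltnP (g 0).+1 n) => [g1|g1].
    by have := nth_word_alt alts g1; rewrite (negPf g0) -/f fg0.
  have := @nth_word_alt _ s alts (g 0).-1.
  have -> : odd (g 0).-1 by move: g0 g1; rewrite /n; case: (g 0) => [|k] /=; lia.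
  by rewrite prednK; [move=> /(_ g0n); rewrite -/f fg0|move: g1; rewrite /n; lia].
(* Odd positions are counted by position, then by value. Each pair contributes 1 to either sum, but
   the value 0 adds 1 to the second. *)
suff : \sum_(i < n) odd i = \sum_(i < n) odd (g i).
  rewrite (big_ord_odd m (fun i => odd i : nat)) (big_ord_odd m (fun i => odd (g i) : nat)).
  rewrite g0 (eq_bigr (fun=> 1)) => [|j _]; last by rewrite /= negbK; case: odd.
  rewrite [in RHS](eq_bigr (fun=> 1)) => [|j _]; first by rewrite /=; lia.
  by have [->|->] := adjg j (ltn_ord j); rewrite /=; case: odd.
rewrite (reindex_inj (@perm_inj _ (s^-1)%g)) /=; apply: eq_bigr => i _.
by rewrite /g nth_word.
Qed.

(** The exceptional odd length, responsible for the isolated term [x] in the generating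
    functions. *)
Lemma signed_alt1 : signed_alt 1 = 1%R.
Proof.
rewrite /signed_alt (big_pred1 1%g) => [|s].
  rewrite /inversions (_ : [set _ | _] = finset.set0) ?cards0 //.
  by apply/setP => -[a b]; rewrite !inE !ord1.
have -> : s = 1%g by apply/permP => i; rewrite !ord1.
by rewrite /= eqxx; apply/alternatingP => i j; rewrite !ord1.
Qed.

Lemma signed_alt_even m : signed_alt m.*2 = ((-1) ^+ m)%R.
Proof.
pose n := m.*2.
have lo_lt (j : 'I_m) : j.*2 + 0 < n by have := ltn_ord j; rewrite /n; lia.
have hi_lt (j : 'I_m) : (j.*2 + 0).+1 < n by have := ltn_ord j; rewrite /n; lia.
pose lo j := Ordinal (lo_lt j); pose hi j := Ordinal (hi_lt j).
rewrite (@signed_alt_fixed n m 0 lo hi) //.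
have s0_lt (i : 'I_n) : (if odd i then i.-1 else i.+1) < n.
  by have := ltn_ord i; rewrite /n; case: ifP; lia.
have s0I : involutive (fun i => Ordinal (s0_lt i)).
  by move=> i; apply: val_inj => /=; case: (boolP (odd i)) => io; case: ifP => /=; lia.
pose s0 := perm (inv_inj s0I).
have s0E i : s0 i = (if odd i then i.-1 else i.+1) :> nat by rewrite permE.
have s0V : (s0^-1)%g = s0.
  by apply/permP => i; apply: (@perm_inj _ s0); rewrite permKV !permE s0I.
rewrite (big_pred1 s0) => [|s].
  (* The inversions of [s0] are the pairs [(lo j, hi j)], read here as positions instead of
     values. *)
  suff -> : inversions s0 = m by [].
  rewrite -[RHS]card_ord -(card_imset (f := fun j => (lo j, hi j)) xpredT).
    apply: eq_card => -[a b]; rewrite !inE /= !s0E.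
    apply/idP/imsetP => [H|[j _ [-> ->]]] /=.
      have am : a./2 < m by have := ltn_ord a; rewrite /n; lia.
      exists (Ordinal am) => //; congr pair; apply: val_inj => /=;
        move: H; case: ifP; case: ifP; lia.
    by rewrite addn0 /= odd_double /=; lia.
  move=> i j /(congr1 (fun p => val p.1)) /= eij.
  by apply: val_inj; move: eij; rewrite /=; lia.
apply/andP/eqP => [[alts /forallP adj]|->].
  pose f := nth 0 (word s); pose g := nth 0 (word (s^-1)%g).
  have H i : i < m -> f i.*2 = i.*2.+1 /\ f i.*2.+1 = i.*2.
    move=> im; apply: (@adjacent_pairs_rigid m f g) => //.
    - exact: nth_word_lt.
    - exact: nth_word_lt.
    - exact: nth_wordK.
    - exact: nth_wordVK.
    - move=> k km; have := @nth_word_alt _ s alts k.*2; rewrite odd_double -/f; apply.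
      by rewrite /n; lia.
    - move=> k km; have := @nth_word_alt _ s alts k.*2.+1; rewrite /= odd_double -/f; apply.
      by rewrite /n; lia.
    - move=> j jm; have := adj (Ordinal jm); rewrite /adjacent -!nth_word /= -/g addn0.
      by case/orP => /eqP; [left|right].
  apply/permP => i; apply: val_inj; rewrite /= s0E -nth_word -/f.
  have im : i./2 < m by have := ltn_ord i; rewrite /n; lia.
  have [e1 e2] := H _ im; have := odd_double_half i; case: (odd i) => /= e.
    by rewrite -e e2.
  by rewrite -e e1.
split.
  apply/alternatingP => i j ij; rewrite !s0E ij /=; case: (boolP (odd i)) => io /=; lia.
apply/forallP => j; rewrite /adjacent s0V !s0E /= addn0 odd_double /=.
by rewrite eqxx orbT.
Qed.

(** * Power series with nonnegative coefficients *)

Local Open Scope classical_set_scope.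
Local Open Scope ring_scope.

Section NonnegPoly.
Variable R : realDomainType.
Implicit Types (p : {poly R}) (x : R).

Lemma horner_coef_ge0 p x : (forall i, 0 <= p`_i) -> 0 <= x -> 0 <= p.[x].
Proof.
by move=> p0 x0; rewrite horner_coef sumr_ge0 // => i _; rewrite mulr_ge0 ?exprn_ge0.
Qed.

Lemma norm_horner_le p x : (forall i, 0 <= p`_i) -> `|p.[x]| <= p.[`|x|].
Proof.
move=> p0; rewrite !horner_coef (le_trans (ler_norm_sum _ _ _)) // ler_sum // => i _.
by rewrite normrM normrX ger0_norm.
Qed.
End NonnegPoly.

Section PowerSeriesNonneg.
Variable R : realType.
Implicit Types (a : R^nat) (x K : R).

(** As polynomials, partial sums can be differentiated formally and compared coefficient by
    coefficient. *)
Lemma pseries_horner a x N : pseries a x N = (\poly_(i < N) a i).[x].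
Proof. by rewrite /pseries /series /= horner_poly big_mkord. Qed.

Lemma pseries_nondecreasing a x : (forall n, 0 <= a n) -> 0 <= x ->
  nondecreasing_seq (pseries a x).
Proof.
move=> a0 x0; apply/nondecreasing_seqP => n.
by rewrite /pseries /series /= big_nat_recr //= lerDl mulr_ge0 ?exprn_ge0.
Qed.

Lemma pseries_diffs_ge0 a : (forall n, 0 <= a n) -> forall n, 0 <= pseries_diffs a n.
Proof. by move=> a0 n; rewrite /pseries_diffs mulr_ge0. Qed.

(** Convexity: the tangent to the power function at [x] stays below its graph at [K]. *)
Lemma pow_secant x K n : 0 <= x <= K ->
  n.+1%:R * x ^+ n * (K - x) <= K ^+ n.+1 - x ^+ n.+1.
Proof.
move=> /andP[x0 xK]; elim: n => [|n IHn]; first by rewrite expr0 !mul1r !expr1.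
have : x * (n.+1%:R * x ^+ n * (K - x)) <= K * (K ^+ n.+1 - x ^+ n.+1).
  by apply: ler_pM => //; rewrite !mulr_ge0 ?exprn_ge0 ?subr_ge0.
rewrite [n.+2%:R]mulrSr [K ^+ n.+2]exprS; set z := K ^+ n.+1.
by rewrite !exprS; set y := x ^+ n; lra.
Qed.

(* By [pow_secant], [(K - x) * n * a n * x ^+ n.-1 <= a n * K ^+ n]. *)
Lemma is_cvg_pseries_diffs a x K : (forall n, 0 <= a n) -> 0 <= x < K ->
  cvgn (pseries a K) -> cvgn (pseries (pseries_diffs a) x).
Proof.
move=> a0 /andP[x0 xK] cK.
have Kx : 0 < K - x by rewrite subr_gt0.
have K0 : 0 <= K := ltW (le_lt_trans x0 xK).
apply: nondecreasing_is_cvgn.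
  exact: pseries_nondecreasing (pseries_diffs_ge0 a0) x0.
exists (limn (pseries a K) / (K - x)) => _ [n _ <-].
rewrite ler_pdivlMr //.
apply: (@le_trans _ _ (pseries a K n.+1)); last first.
  apply: nondecreasing_cvgn_le => //; exact: pseries_nondecreasing.
rewrite /pseries /series /= big_nat_recl // mulr_suml.
apply: (@le_trans _ _ (\sum_(0 <= i < n) a i.+1 * K ^+ i.+1)); last first.
  by rewrite lerDr mulr_ge0 ?exprn_ge0.
apply: ler_sum => i _; rewrite /pseries_diffs.
have -> : i.+1%:R * a i.+1 * x ^+ i * (K - x) = a i.+1 * (i.+1%:R * x ^+ i * (K - x)) by ring.
apply: ler_wpM2l => //; apply: le_trans (@pow_secant x K i _) _.
  by rewrite x0 ltW.
by rewrite gerBl exprn_ge0.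
Qed.

Lemma is_derive_pseries a x K : (forall n, 0 <= a n) -> `|x| < K ->
  cvgn (pseries a K) ->
  is_derive x (1 : R) (fun y => limn (pseries a y)) (limn (pseries (pseries_diffs a) x)).
Proof.
move=> a0 xK cK.
(* Termwise differentiation asks for convergence of the first two derived series beyond the modulus
   of [x]. Each derivation costs a smaller point: [K] for the series, [v] and then [u] for the
   derived ones. *)
pose u := (`|x| + K) / 2; pose v := (u + K) / 2; pose w := (`|x| + u) / 2.
have x0 := normr_ge0 x.
have [xw wu uv vK] : [/\ `|x| < w, w < u, u < v & v < K].
  by rewrite /w /v /u; split; lra.
have d0 := pseries_diffs_ge0 a0.
have cv : cvgn (pseries (pseries_diffs a) v) by apply: is_cvg_pseries_diffs cK => //; lra.
apply: (@pseries_snd_diffs _ _ u).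
- apply: is_cvg_pseries_inside cK _; rewrite !ger0_norm; lra.
- apply: is_cvg_pseries_inside cv _; rewrite !ger0_norm; lra.
- apply: is_cvg_pseries_diffs cv => //; lra.
- by rewrite (ger0_norm (x := u)); lra.
Qed.

End PowerSeriesNonneg.

(** * The Riccati equation 2 f' = 1 + f^2 *)

Lemma is_derive_MVT (R : realType) (f df : R -> R) (a b : R) : a <= b ->
  (forall x, x \in `[a, b] -> is_derive x (1 : R) f (df x)) ->
  exists2 c, c \in `[a, b] & f b - f a = df c * (b - a).
Proof.
move=> ab H.
have H1 x : x \in `]a, b[ -> is_derive x (1 : R) f (df x).
  by move=> xab; apply: H; exact: (subset_itv_oo_cc xab).
have H2 : {within `[a, b], continuous f}.
  by apply: derivable_within_continuous => x /H [].
exact: MVT_segment ab H1 H2.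
Qed.

Lemma is_derive_atan_comp (R : realType) (f : R -> R) (x df : R) :
  is_derive x (1 : R) f df ->
  is_derive x (1 : R) (fun y => atan (f y)) (df / (1 + f x ^+ 2)).
Proof.
move=> Hf; rewrite mulrC.
exact: (@is_derive1_comp _ atan f x (1 + f x ^+ 2)^-1 df).
Qed.

(** The differential inequality bounds the derivative of [atan (f x)] by 1/2. *)
Lemma atan_growth_le (R : realType) (f df : R -> R) (a b : R) : a <= b ->
  (forall x, x \in `[a, b] -> is_derive x (1 : R) f (df x)) ->
  (forall x, x \in `[a, b] -> 2 * df x <= 1 + f x ^+ 2) ->
  atan (f b) - atan (f a) <= (b - a) / 2.
Proof.
move=> ab Hf Hd.
have [c cab ->] := is_derive_MVT ab (fun x xab => is_derive_atan_comp (Hf x xab)).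
rewrite mulrC ler_wpM2l ?subr_ge0 // ler_pdivrMr ?ltr_wpDr ?sqr_ge0 //.
by have := Hd c cab; lra.
Qed.

Section Riccati.
Variables (R : realType) (a : R^nat).
Hypothesis a_ge0 : forall n, 0 <= a n.
Hypothesis a0 : a 0 = 1.
(** The equation [2 f' = 1 + f^2] read on coefficients; [(n == 0)%:R] is the constant 1. *)
Hypothesis a_rec : forall n,
  2 * (n.+1%:R * a n.+1) = \sum_(k < n.+1) a k * a (n - k)%N + (n == 0)%:R.

Let P N := \poly_(i < N) a i.
Let D N := \poly_(i < N) pseries_diffs a i.

Let coefP N i : (P N)`_i <= a i.
Proof. by rewrite coef_poly; case: ifP. Qed.

Let coefP_ge0 N i : 0 <= (P N)`_i.
Proof. by rewrite coef_poly; case: ifP. Qed.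

Let derivP N : (P N.+1)^`() = D N.
Proof.
apply/polyP => i; rewrite coef_deriv !coef_poly ltnS /pseries_diffs.
by case: ifP; rewrite ?mul0rn // mulr_natl.
Qed.

(** Below degree [N] the recurrence makes the coefficients vanish; from [N] on [D N] has none, and
    only nonnegative terms remain. *)
Let riccati_defect_ge0 N i : 0 <= (1 + P N * P N - 2%:P * D N)`_i.
Proof.
rewrite coefB coefCM coefD coefM coef1 coef_poly.
case: ltnP => iN; last first.
  by rewrite mulr0 subr0 addr_ge0 ?sumr_ge0 // => j _; rewrite mulr_ge0.
rewrite /pseries_diffs a_rec subr_ge0 [leRHS]addrC lerD2r.
rewrite le_eqVlt; apply/orP; left; apply/eqP; apply: eq_bigr => j _.
rewrite !coef_poly (leq_ltn_trans _ iN) ?(leq_ltn_trans _ iN) ?leq_subr //.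
by rewrite -ltnS.
Qed.

(* [P N * P N] has degree at most [N + N], and its coefficients are truncated
   convolutions of those of [a]. *)
Let riccati_defect_le0 N i : 0 <= (2%:P * D (N + N).+1 - (1 + P N * P N))`_i.
Proof.
rewrite coefB coefCM coefD coefM coef1 coef_poly.
case: ltnP => iN; last first.
  rewrite mulr0 sub0r (_ : (i == 0)%N = false) ?add0r; last by case: i iN.
  rewrite big1 ?oppr0 // => j _; rewrite !coef_poly.
  case: ltnP => jN; rewrite ?mul0r //; case: ltnP => ijN; rewrite ?mulr0 //.
  by move: iN jN ijN (ltn_ord j); move: (j : nat) => k; lia.
rewrite /pseries_diffs a_rec subr_ge0 addrC lerD2r.
by apply: ler_sum => j _; apply: ler_pM.
Qed.

Let pseriesP y N : pseries a y N = (P N).[y].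
Proof. exact: pseries_horner. Qed.

Let pseriesD y N : pseries (pseries_diffs a) y N = (D N).[y].
Proof. exact: pseries_horner. Qed.

Let defectE N y : (1 + P N * P N - 2%:P * D N).[y] =
  1 + pseries a y N ^+ 2 - 2 * pseries (pseries_diffs a) y N.
Proof. by rewrite pseriesP pseriesD !hornerE expr2. Qed.

Lemma riccati_sub y N : 0 <= y ->
  2 * pseries (pseries_diffs a) y N <= 1 + pseries a y N ^+ 2.
Proof. by move=> y0; rewrite -subr_ge0 -defectE; exact: horner_coef_ge0. Qed.

(** The converse of [riccati_sub], at the price of a longer derived sum; together they force
    equality in the limit for nonnegative [y]. *)
Lemma riccati_super y N : 0 <= y ->
  1 + pseries a y N ^+ 2 <= 2 * pseries (pseries_diffs a) y (N + N).+1.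
Proof.
move=> y0; have := horner_coef_ge0 (riccati_defect_le0 N) y0.
by rewrite !hornerE -expr2 -pseriesP -pseriesD subr_ge0.
Qed.

(* Transfers the limit from [`|y|] to negative [y] without a Cauchy product. *)
Lemma riccati_defect_norm y N :
  `|1 + pseries a y N ^+ 2 - 2 * pseries (pseries_diffs a) y N| <=
  1 + pseries a `|y| N ^+ 2 - 2 * pseries (pseries_diffs a) `|y| N.
Proof. by rewrite -!defectE; exact: norm_horner_le. Qed.

Lemma pseries0 N : pseries a 0 N.+1 = 1.
Proof.
rewrite /pseries /series /= big_nat_recl // expr0 mulr1 a0 big1 ?addr0 // => i _.
by rewrite expr0n mulr0.
Qed.

Lemma pseries_le_tan y N : 0 <= y < pi / 2 -> pseries a y N <= tan (pi / 4 + y / 2).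
Proof.
move=> /andP[y0 yp].
have pi0 : 0 < pi :> R by exact: pi_gt0.
(* With index [N.+1] the sum has the value 1 at 0 and the derivative [D N]. *)
apply: (@le_trans _ _ (pseries a y N.+1)); first exact: pseries_nondecreasing.
have H : atan (pseries a y N.+1) <= pi / 4 + y / 2.
  have der z : z \in `[0, y] -> is_derive z (1 : R) (horner (P N.+1)) (D N).[z].
    by move=> _; rewrite -derivP; exact: is_derive_poly.
  have rate z : z \in `[0, y] -> 2 * (D N).[z] <= 1 + (P N.+1).[z] ^+ 2.
    rewrite in_itv /= => /andP[z0 _]; rewrite -pseriesD -pseriesP.
    apply: le_trans (riccati_sub N z0) _; rewrite lerD2l lerXn2r ?nnegrE //.
    - by rewrite pseriesP horner_coef_ge0.
    - by rewrite pseriesP horner_coef_ge0.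
    - exact: pseries_nondecreasing.
  have := atan_growth_le y0 der rate.
  by rewrite -!pseriesP pseries0 atan1 subr0; lra.
rewrite leNgt; apply/negP => /lt_atan; rewrite tanK; first by rewrite ltNge H.
by rewrite in_itv /=; apply/andP; split; lra.
Qed.

(** At [K] the partial sums increase and are bounded; this gives convergence at all points of
    smaller modulus, negative ones included. *)
Lemma is_cvg_riccati y : `|y| < pi / 2 -> cvgn (pseries a y).
Proof.
move=> yp; pose K := (`|y| + pi / 2) / 2; have y0 := normr_ge0 y.
have [yK Kp] : `|y| < K /\ K < pi / 2 by rewrite /K; split; lra.
have K0 : 0 <= K by lra.
apply: (@is_cvg_pseries_inside _ a K); last by rewrite (ger0_norm K0).
apply: nondecreasing_is_cvgn; first exact: pseries_nondecreasing.
by exists (tan (pi / 4 + K / 2)) => _ [n _ <-]; apply: pseries_le_tan; rewrite K0.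
Qed.

Lemma is_derive_riccati y : `|y| < pi / 2 ->
  is_derive y (1 : R) (fun z => limn (pseries a z)) (limn (pseries (pseries_diffs a) y)).
Proof.
move=> yp; pose K := (`|y| + pi / 2) / 2; have y0 := normr_ge0 y.
have [yK Kp] : `|y| < K /\ K < pi / 2 by rewrite /K; split; lra.
apply: (is_derive_pseries a_ge0 yK); apply: is_cvg_riccati.
by rewrite ger0_norm //; lra.
Qed.

Lemma is_cvg_riccati_diffs y : `|y| < pi / 2 -> cvgn (pseries (pseries_diffs a) y).
Proof.
move=> yp; pose K := (`|y| + pi / 2) / 2; pose L := (`|y| + K) / 2.
have y0 := normr_ge0 y.
have [yL LK Kp] : [/\ `|y| < L, L < K & K < pi / 2] by rewrite /L /K; split; lra.
apply: (@is_cvg_pseries_inside _ _ L); last by rewrite (ger0_norm (x := L)) //; lra.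
apply: (@is_cvg_pseries_diffs _ _ _ K a_ge0); first by lra.
by apply: is_cvg_riccati; rewrite ger0_norm; lra.
Qed.

Lemma riccati_limit y : `|y| < pi / 2 ->
  2 * limn (pseries (pseries_diffs a) y) = 1 + limn (pseries a y) ^+ 2.
Proof.
move=> yp.
have cdef z : `|z| < pi / 2 ->
    (fun N => 1 + pseries a z N ^+ 2 - 2 * pseries (pseries_diffs a) z N) @ \oo -->
    1 + limn (pseries a z) ^+ 2 - 2 * limn (pseries (pseries_diffs a) z).
  move=> zp; have ca := is_cvg_riccati zp; have cd := is_cvg_riccati_diffs zp.
  apply: cvgB; last by apply: cvgM; [exact: cvg_cst|].
  by apply: cvgD; [exact: cvg_cst|rewrite expr2; under eq_fun do rewrite expr2; exact: cvgM].
have yp' : `| `|y| | < pi / 2 by rewrite normr_id.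
have def0 : 1 + limn (pseries a `|y|) ^+ 2 - 2 * limn (pseries (pseries_diffs a) `|y|) = 0.
  have y0 := normr_ge0 y.
  apply/eqP; rewrite eq_le; apply/andP; split.
    rewrite subr_le0 -lerBrDl.
    have cs : (fun N => pseries a `|y| N ^+ 2) @ \oo --> limn (pseries a `|y|) ^+ 2.
      by rewrite expr2; under eq_fun do rewrite expr2; apply: cvgM; exact: is_cvg_riccati.
    apply: (cvgr_to_le cs); near=> N; rewrite lerBrDl.
    apply: le_trans (riccati_super N y0) _; rewrite ler_pM2l //.
    apply: nondecreasing_cvgn_le; last exact: is_cvg_riccati_diffs.
    exact: pseries_nondecreasing (pseries_diffs_ge0 a_ge0) y0.
  apply: (cvgr_to_ge (cdef _ yp')); near=> N.
  by rewrite subr_ge0; exact: riccati_sub.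
(* The defect at [y] is dominated by the defect at its absolute value, which tends to 0. *)
have /norm_cvg0P c0 : (fun N => `|1 + pseries a y N ^+ 2 - 2 * pseries (pseries_diffs a) y N|)
    @ \oo --> (0 : R).
  have := cdef _ yp'; rewrite def0 => c1.
  apply: (squeeze_cvgr _ (cvg_cst 0) c1).
  by near=> N; rewrite normr_ge0 riccati_defect_norm.
have e1 := cvg_lim (@Rhausdorff R) (cdef _ yp).
have e2 := cvg_lim (@Rhausdorff R) c0.
by apply/eqP; rewrite eq_sym -subr_eq0 -e1 e2.
Unshelve. all: by end_near. Qed.

(** The arctangent of the sum has constant derivative 1/2 and the value [pi / 4] at 0. *)
Lemma limn_riccati y : `|y| < pi / 2 -> limn (pseries a y) = tan (pi / 4 + y / 2).
Proof.
move=> yp.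
have f0 : limn (pseries a 0) = 1.
  apply: cvg_lim => //; rewrite -cvg_shiftS.
  by under eq_fun do rewrite pseries0; exact: cvg_cst.
have der z : `|z| < pi / 2 ->
    is_derive z (1 : R) (fun z => atan (limn (pseries a z))) (1 / 2).
  move=> zp; have := is_derive_atan_comp (is_derive_riccati zp).
  suff -> : limn (pseries (pseries_diffs a) z) / (1 + limn (pseries a z) ^+ 2) = 1 / 2 by [].
  have : 1 + limn (pseries a z) ^+ 2 != 0 by rewrite gt_eqF // ltr_pwDl ?sqr_ge0.
  by rewrite -riccati_limit // => n0; field; move: n0; rewrite mulf_eq0 negb_or => /andP[].
have at_y : atan (limn (pseries a y)) = pi / 4 + y / 2.
  move: yp; rewrite ltr_norml => /andP[yl yr].
  have [y0|y0] := leP 0 y.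
    have H z : z \in `[0, y] ->
        is_derive z (1 : R) (fun z => atan (limn (pseries a z))) (1 / 2).
      by rewrite in_itv /= => /andP[z0 zy]; apply: der; rewrite ltr_norml; lra.
    have [c _] := is_derive_MVT y0 H.
    by rewrite f0 atan1 subr0; lra.
  have H z : z \in `[y, 0] ->
      is_derive z (1 : R) (fun z => atan (limn (pseries a z))) (1 / 2).
    by rewrite in_itv /= => /andP[z0 zy]; apply: der; rewrite ltr_norml; lra.
  have [c _] := is_derive_MVT (ltW y0) H.
  by rewrite f0 atan1 sub0r; lra.
by rewrite -at_y atanK.
Qed.

End Riccati.

(** With [c] and [s] the cosine and sine of [y / 2], the left side is [(c + s) / (c - s) = (c + s)^2
    / (c^2 - s^2) = (1 + sin y) / cos y]. *)
Lemma tan_quarter_half (R : realType) (y : R) : `|y| < pi / 2 ->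
  tan (pi / 4 + y / 2) = sec y + tan y.
Proof.
rewrite ltr_norml => /andP[yl yr].
have cy : cos y != 0 by rewrite gt_eqF // cos_gt0_pihalf // yl.
have pi0 : 0 < pi :> R := pi_gt0 R.
have ch : cos (y / 2) != 0 by rewrite gt_eqF // cos_gt0_pihalf //; lra.
have cq : cos (pi / 4) != 0 :> R by rewrite gt_eqF // cos_gt0_pihalf //; lra.
rewrite tanD // tan_piquarter mul1r /sec /tan.
have e : y = y / 2 + y / 2 by lra.
have cE : cos y = cos (y / 2) ^+ 2 - sin (y / 2) ^+ 2 by rewrite {1}e cosD !expr2.
have sE : sin y = 2 * sin (y / 2) * cos (y / 2) by rewrite {1}e sinD; ring.
have := cos2Dsin2 (y / 2).
move: cy ch; rewrite cE sE; set c := cos _; set s := sin _ => cy ch e1.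
have -> : (c ^+ 2 - s ^+ 2)^-1 + 2 * s * c / (c ^+ 2 - s ^+ 2) =
    (c ^+ 2 + s ^+ 2 + 2 * s * c) / (c ^+ 2 - s ^+ 2) by rewrite e1 [RHS]mulrDl div1r.
have n1 : c - s != 0.
  by apply: contra cy => /eqP n0; rewrite subr_sqr n0 mul0r.
by field; rewrite cy ch n1.
Qed.

(** * Generating functions *)

Section Series.
Variable R : realType.

Definition alt_coef (n : nat) : R := (Eplus n + Eminus n)%:R / n`!%:R.

Lemma alt_coef_ge0 n : 0 <= alt_coef n.
Proof. by rewrite /alt_coef divr_ge0. Qed.

Lemma alt_coef0 : alt_coef 0 = 1.
Proof. by rewrite /alt_coef Eplus0 Eminus0 divr1. Qed.

Lemma alt_coef_rec n :
  2 * (n.+1%:R * alt_coef n.+1) =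
  \sum_(k < n.+1) alt_coef k * alt_coef (n - k)%N + (n == 0)%:R.
Proof.
have nz k : k`!%:R != 0 :> R by rewrite pnatr_eq0 -lt0n fact_gt0.
have -> : 2 * (n.+1%:R * alt_coef n.+1) = (zigzag (iota 0 n.+1)).*2%:R / n`!%:R.
  rewrite /alt_coef EplusDEminus factS natrM -muln2 natrM.
  have nS : n.+1%:R != 0 :> R by rewrite pnatr_eq0.
  move: nS (nz n); move: (n.+1%:R : R) (n`!%:R : R) => c d c0 d0.
  by field; rewrite d0 c0.
(* For [n = 0] the two sides of the recurrence for counts are 2 and 1; the extra term [(n == 0)%:R]
   makes up the difference. *)
case: n => [|n].
  by rewrite big_ord_recl big_ord0 /= subn0 alt_coef0 mulr1 addr0 divr1.
rewrite zigzag_rec // addr0 natr_sum mulr_suml; apply: eq_bigr => k _.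
have kn : (k <= n.+1)%N by rewrite -ltnS.
have C0 : 'C(n.+1, k)%:R != 0 :> R by rewrite pnatr_eq0 -lt0n bin_gt0.
rewrite /alt_coef !EplusDEminus -(bin_fact kn) !natrM.
move: C0 (nz k) (nz (n.+1 - k)%N).
move: ('C(n.+1, k)%:R : R) (k`!%:R : R) ((n.+1 - k)`!%:R : R) => c d f c0 d0 f0.
by field; rewrite f0 d0 c0.
Qed.

(** The right side is [n!] times the coefficient of [x^n] in [cos x + x]. *)
Lemma EplusBEminus n : (Eplus n)%:R - (Eminus n)%:R =
  (~~ odd n)%:R * (-1) ^+ n./2 + (n == 1)%:R :> R.
Proof.
transitivity ((signed_alt n)%:~R : R).
  by rewrite signed_altE rmorphB /= -!pmulrn.
have := odd_double_half n; case: (odd n) => <- /=; last first.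
  rewrite add0n doubleK signed_alt_even mul1r rmorphXn /= rmorphN1.
  by case: (n./2) => [|k]; rewrite ?doubleS /= addr0.
rewrite mul0r add0r add1n; case: (n./2) => [|k]; first by rewrite signed_alt1.
by rewrite signed_alt_odd // doubleS.
Qed.

Lemma cvg_pseries_X (x : R) : pseries (fun n => (n == 1)%:R) x @ \oo --> x.
Proof.
rewrite -cvg_shiftS -cvg_shiftS.
have -> : (fun n => pseries (fun n => (n == 1)%:R) x n.+2) = cst x; last exact: cvg_cst.
apply/funext => n; rewrite /pseries /series /= big_nat_recl // big_nat_recl //= mul0r add0r.
by rewrite expr1 mul1r big1 ?addr0 // => i _; rewrite mul0r.
Qed.

Lemma cvg_pseries_alt (x : R) : `|x| < pi / 2 ->
  pseries alt_coef x @ \oo --> sec x + tan x.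
Proof.
move=> xp; have c := is_cvg_riccati alt_coef_ge0 alt_coef0 alt_coef_rec xp.
by rewrite -tan_quarter_half // -(limn_riccati alt_coef_ge0 alt_coef0 alt_coef_rec xp).
Qed.

Lemma cvg_cos_series (x : R) : series (cos_coeff x) @ \oo --> cos x.
Proof. by rewrite unlock; exact: is_cvg_series_cos_coeff. Qed.

(** Both counts at once: [e = 1] gives [Eplus] and [e = -1] gives [Eminus]. *)
Lemma egf_split (e : R) (u : nat -> nat) (x : R) :
  (forall n, (u n)%:R = 2^-1 * ((Eplus n + Eminus n)%:R
     + e * ((Eplus n)%:R - (Eminus n)%:R)) :> R) ->
  egf_series u x = (fun N => 2^-1 * (pseries alt_coef x N
     + e * (series (cos_coeff x) N + pseries (fun n => (n == 1)%:R) x N))).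
Proof.
move=> Hu; apply/funext => N; rewrite /egf_series /pseries /series /=.
rewrite -big_split mulr_sumr -big_split mulr_sumr; apply: eq_bigr => n _ /=.
rewrite Hu EplusBEminus /alt_coef /cos_coeff /=.
have n0 : n`!%:R != 0 :> R by rewrite pnatr_eq0 -lt0n fact_gt0.
(* The series of [x] is written without a factorial, which agrees with the coefficient at [n = 1]
   because [1! = 1]. *)
have [->|n1] := eqVneq n 1%N.
  by rewrite /= !divr1; ring.
rewrite -?exprnP mulr0n mul0r !addr0.
by field.
Qed.

Lemma cvg_egf (e : R) (x : R) : `|x| < pi / 2 ->
  (fun N => 2^-1 * (pseries alt_coef x N
     + e * (series (cos_coeff x) N + pseries (fun n => (n == 1)%:R) x N))) @ \oo -->
  2^-1 * (sec x + tan x + e * (cos x + x)).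
Proof.
move=> xp; apply: cvgM; first exact: cvg_cst.
apply: cvgD; first exact: cvg_pseries_alt.
apply: cvgM; first exact: cvg_cst.
by apply: cvgD; [exact: cvg_cos_series|exact: cvg_pseries_X].
Qed.
End Series.

Theorem theorem7 (R : realType) (x : R) (hx : `|x| < pi / 2) :
  (egf_series Eplus x @ \oo --> 2^-1 * (sec x + tan x + cos x + x)) /\
  (egf_series Eminus x @ \oo --> 2^-1 * (sec x + tan x - cos x - x)).
Proof.
split.
  rewrite (@egf_split R 1) => [|n]; last by rewrite natrD; field.
  have -> : sec x + tan x + cos x + x = sec x + tan x + 1 * (cos x + x) by ring.
  exact: cvg_egf.
rewrite (@egf_split R (-1)) => [|n]; last by rewrite natrD; field.
have -> : sec x + tan x - cos x - x = sec x + tan x + (-1) * (cos x + x) by ring.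
exact: cvg_egf.
Qed.
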